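(* Let $L$ be a finite relatively complemented lattice and let $F \subseteq L$ be a family for which the set $L \setminus \mathrm{Str}(F)$ contains exactly one minimal element. Then $|F| \le |\mathrm{Str}(F)|$.
   Context: All posets are finite. A family (subset) $F \subseteq L$ shatters $y \in L$ if for every $x \le y$ there exists $z \in F$ with $z \wedge y = x$; $\mathrm{Str}(F)$ is the set of all elements of $L$ shattered by $F$. Minimal elements of $L \setminus \mathrm{Str}(F)$ are taken with respect to the order inherited from $L$. $L$ is relatively complemented (RC) if every interval $[x,y]=\{z : x \le z \le y\}$ is a complemented lattice: for every $z \in [x,y]$ there is $w \in [x,y]$ with $z \wedge w = x$ and $z \vee w = y$. *)

(* Defs.v *)
From HB Require Import structures.
From mathcomp Require Import all_boot all_order.

Set Implicit Arguments.
Unset Strict Implicit.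
Unset Printing Implicit Defensive.

Import Order.TTheory.
Local Open Scope order_scope.

Section Shattering.
Variables (d : Order.disp_t) (L : finLatticeType d).
Implicit Types (F A : {set L}) (x y z w : L).

Definition relatively_complemented : Prop :=
  forall x y z, x <= z <= y ->
    exists2 w, x <= w <= y & z `&` w = x /\ z `|` w = y.

Definition shatters F y : bool :=
  [forall (x | x <= y), exists z in F, z `&` y == x].

Definition Str F : {set L} := [set y | shatters F y].

Definition minimals A : {set L} :=
  [set y in A | [forall z in A, (z <= y) ==> (z == y)]].

End Shattering.

Arguments relatively_complemented {d} L.

(* Main.v *)
Require Import Defs.
From mathcomp Require Import all_boot all_order.

Import Order.TTheory.

(** Let [m] be the unique minimal element of the complement of [Str F].  Every
    unshattered element lies above a minimal one, hence above [m], so [Str F]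
    contains every [y] with [~~ (m <= y)].  It thus suffices that the complement
    of [F] has at least as many elements as the principal filter of [m].
    As [F] does not shatter [m], some [x <= m] is not of the form [z `&` m] with
    [z] in [F], so [F] misses the whole fibre [{w | w `&` m = x}].  For each
    [z >= m], a complement [w] of [m] in the interval [[x, z]] lies in this
    fibre, and [z = w `|` m] is recovered from [w]; so the fibre is at least as
    large as the filter ([leq_card_filter_fibre]). *)

Lemma minimals_below (d : Order.disp_t) (L : finLatticeType d) (A : {set L})
    (y : L) :
  y \in A -> exists2 m, m \in minimals A & (m <= y)%O.
Proof.
move=> yA.
have y_ok : (y \in A) && (y <= y)%O by rewrite yA lexx.
case: (arg_minnP (P := fun z => (z \in A) && (z <= y)%O)
  (fun z => #|[set t : L | (t <= z)%O]|) y_ok) => m /andP[mA le_my] m_min.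
exists m => //; rewrite inE mA; apply/forall_inP => z zA; apply/implyP => le_zm.
have le_card := m_min z; rewrite zA (le_trans le_zm le_my) in le_card.
(* The two principal ideals are nested, so comparing sizes makes them equal. *)
have sub_zm : [set t : L | (t <= z)%O] \subset [set t : L | (t <= m)%O].
  by apply/subsetP => t; rewrite !inE => /le_trans; apply.
have eq_zm : [set t : L | (t <= z)%O] = [set t : L | (t <= m)%O].
  by apply/eqP; rewrite eqEcard sub_zm le_card.
have : m \in [set t : L | (t <= z)%O] by rewrite eq_zm inE.
by rewrite inE => le_mz; rewrite eq_le le_zm le_mz.
Qed.

Lemma leq_card_filter_fibre (d : Order.disp_t) (L : finLatticeType d)
    (m x : L) :
  relatively_complemented L -> (x <= m)%O ->
  #|[set z : L | (m <= z)%O]| <= #|[set w : L | (w `&` m)%O == x]|.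
Proof.
move=> rcL le_xm; set fibre := [set w : L | _ == x].
suff sub : [set z : L | (m <= z)%O] \subset [set (w `|` m)%O | w in fibre].
  exact: leq_trans (subset_leq_card sub) (leq_imset_card _ _).
apply/subsetP => z; rewrite inE => le_mz.
have [|w _ [meet_w join_w]] := rcL x z m; first by rewrite le_xm.
by apply/imsetP; exists w; rewrite ?inE 1?meetC ?meet_w // joinC.
Qed.

Theorem theorem1p7 (d : Order.disp_t) (L : finLatticeType d) (F : {set L})
  (hL : relatively_complemented L)
  (hF : #|minimals (~: Str F)| = 1) :
  #|F| <= #|Str F|.
Proof.
have /cards1P[m minE] : #|minimals (~: Str F)| == 1 by rewrite hF.
have : m \in minimals (~: Str F) by rewrite minE set11.
rewrite inE => /andP[+ _]; rewrite !inE negb_forall => /existsP[x].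
rewrite negb_imply => /andP[le_xm /exists_inPn x_missed].
have filter_sub : ~: [set z : L | (m <= z)%O] \subset Str F.
  apply/subsetP => y; rewrite !inE; apply: contraR => y_nStr.
  have [|m'] := minimals_below d L (~: Str F) y; first by rewrite !inE.
  by rewrite minE inE => /eqP ->.
have F_sub : F \subset ~: [set w : L | (w `&` m)%O == x].
  by apply/subsetP => w wF; rewrite !inE x_missed.
apply: leq_trans (subset_leq_card F_sub) _.
apply: leq_trans _ (subset_leq_card filter_sub).
by rewrite [leqLHS]cardsCs [leqRHS]cardsCs !setCK leq_sub2l // leq_card_filter_fibre.
Qed.
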